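(* Let $d\ge 2$, $b>0$ and $\nu_d<0$ be fixed. For $a\ge1$ let $\mu_a^{(d)}$ be the full-dimensional facet submodel (with intensity function of facet centres $\chi\equiv 1$), and let $\pi=\pi_a=P_{\mu_a^{(d)}}\theta^{-1}$ be the distribution on $\mathbb{N}_0^d$ of the vector $(\theta_1(\mu_a^{(d)}),\dots,\theta_d(\mu_a^{(d)}))$ of numbers of facets with each orientation. Then $$\lim_{a\to\infty}\ \sum_{k_1=1}^\infty\cdots\sum_{k_d=1}^\infty \pi_a(k_1,\dots,k_d)=0.$$
   Context: Let $\mathbb{N}_0=\{0,1,2,\dots\}$ and $[d]=\{1,\dots,d\}$, and let $e_1,\dots,e_d$ be the standard orthonormal basis of $\mathbb{R}^d$. Facets: $Y=[0,b]^d\times\{2b\}\times\{e_1,\dots,e_d\}$. A point $((z_1,\dots,z_d),2b,e_l)\in Y$ is identified with the facet $\{(x_1,\dots,x_d)\in\mathbb{R}^d:\ x_l=z_l,\ |x_i-z_i|\le b\ \text{for } i\in[d]\setminus\{l\}\}$; $e_l$ is its orientation. Measure: $\lambda$ is the finite measure on $Y$ given by $\lambda(\mathrm{d}(z,r,\phi))=\chi(z)\,\mathrm{d}z\,\delta_{2b}(\mathrm{d}r)\,\frac1d\sum_{i=1}^d\delta_{e_i}(\mathrm{d}\phi)$, where $\delta$ denotes Dirac measure; here $\chi\equiv 1$ on $[0,b]^d$. $\mathbf{N}$ is the space of integer-valued finite measures on $Y$ whose atoms all have mass one, identified with finite subsets $\mathbf{x}\subset Y$, with the smallest $\sigma$-algebra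 making all maps $\mathbf{x}\mapsto\mathbf{x}(B)$, $B\subset Y$ Borel, measurable. $\eta_a$ is the Poisson process on $Y$ with intensity measure $a\lambda$. For $\mathbf{x}\in\mathbf{N}$ put $G_d(\mathbf{x})=\frac{1}{d!}\sum_{(x_1,\dots,x_d)\in\mathbf{x}^d_{\neq}}\mathbb{H}^0\left(\bigcap_{i=1}^d x_i\right)$, where the sum is over ordered $d$-tuples of distinct points of $\mathbf{x}$ and $\mathbb{H}^0$ is counting measure (the Hausdorff measure of order $0$). The full-dimensional submodel $\mu_a^{(d)}$ is the point process on $Y$ with density $p(\mathbf{x})=c_a\exp(\nu_d G_d(\mathbf{x}))$ with respect to the distribution of $\eta_a$, where $\nu_d<0$ and $c_a$ is the normalizing constant. The map $\theta:\mathbf{N}\to\mathbb{N}_0^d$, $\theta(\mathbf{x})=(\theta_1(\mathbf{x}),\dots,\theta_d(\mathbf{x}))$, is defined by letting $\theta_i(\mathbf{x})$ be the number of facets in $\mathbf{x}$ with orientation $e_i$. $P_{\mu_a^{(d)}}$ denotes the distribution of $\mu_a^{(d)}$. *)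

(* Defs.v *)
From HB Require Import structures.
From mathcomp Require Import all_boot all_order all_algebra finmap.
From mathcomp Require Import all_classical all_reals all_analysis.

Set Implicit Arguments.
Unset Strict Implicit.
Unset Printing Implicit Defensive.

Import Order.TTheory GRing.Theory Num.Theory.
Import numFieldNormedType.Exports.

Local Open Scope classical_set_scope.
Local Open Scope ring_scope.

(* Lebesgue measure on R^n, as the n-fold product of Lebesgue measure on R; R^n
   is n.-tuple R, whose sigma-algebra is generated by the coordinates. *)
Section lebesgue_tuple.
Context {R : realType}.

Definition cons_tuple_fun n (p : measurableTypeR R * n.-tuple R) :
  n.+1.-tuple R := [tuple of p.1 :: p.2].

Lemma measurable_cons_tuple_fun n : measurable_fun setT (@cons_tuple_fun n).
Proof. by apply: (measurable_cons measurable_fst measurable_snd). Qed.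

Section step.
Variables (n : nat) (m : {sigma_finite_measure set (n.-tuple R) -> \bar R}).

Definition lebesgue_step : set (n.+1.-tuple R) -> \bar R :=
  pushforward (@lebesgue_measure R \x m)%E (@cons_tuple_fun n).

Let lebesgue_step0 : lebesgue_step set0 = 0%E.
Proof. by rewrite /lebesgue_step /pushforward preimage_set0 measure0. Qed.

Let lebesgue_step_ge0 A : (0 <= lebesgue_step A)%E.
Proof. exact: (measure_ge0 (@lebesgue_measure R \x m)%E). Qed.

Let lebesgue_step_sigma_additive : semi_sigma_additive lebesgue_step.
Proof.
move=> F mF tF mUF; rewrite /lebesgue_step /pushforward preimage_bigcup.
have mpre A : measurable A -> measurable (@cons_tuple_fun n @^-1` A).
  by move=> mA; rewrite -[X in measurable X]setTI; apply: measurable_cons_tuple_fun.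
apply: (@measure_semi_sigma_additive _ _ _ (@lebesgue_measure R \x m)%E).
- by move=> k; exact: mpre.
- apply/trivIsetP => i j _ _ ij; rewrite -preimage_setI.
  by move/trivIsetP : tF => /(_ _ _ _ _ ij) ->//; rewrite preimage_set0.
- by rewrite -preimage_bigcup; exact: mpre.
Qed.

HB.instance Definition _ := isMeasure.Build _ _ _ lebesgue_step
  lebesgue_step0 lebesgue_step_ge0 lebesgue_step_sigma_additive.

Let uncons (t : n.+1.-tuple R) : measurableTypeR R * n.-tuple R :=
  (thead t, [tuple of behead t]).

Let measurable_uncons : measurable_fun setT uncons.
Proof.
apply/measurable_fun_pairP; split; first exact: measurable_tnth.
exact: measurable_behead.
Qed.

Let lebesgue_step_sigma_finite : sigma_finite setT lebesgue_step.
Proof.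
have /sigma_finiteP[F [TF ndF Foo]] := sigma_finiteT (@lebesgue_measure R).
have /sigma_finiteP[H [TH ndH Hoo]] := sigma_finiteT m.
exists (fun k => uncons @^-1` (F k `*` H k)).
  rewrite -preimage_bigcup (_ : \bigcup_k _ = setT) ?preimage_setT//.
  apply/seteqP; split=> // -[x t] _.
  have [p _ Fpx] : (\bigcup_k F k) x by rewrite -TF.
  have [q _ Hqt] : (\bigcup_k H k) t by rewrite -TH.
  exists (maxn p q) => //; split.
  - by move: x Fpx; exact/subsetPset/ndF/leq_maxl.
  - by move: t Hqt; exact/subsetPset/ndH/leq_maxr.
move=> k; have [mF Fk] := Foo k; have [mH Hk] := Hoo k.
have mFH : measurable (F k `*` H k) by exact: measurableX.
split; first by rewrite -[X in measurable X]setTI; exact: measurable_uncons.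
rewrite /lebesgue_step /pushforward -comp_preimage.
rewrite (_ : uncons \o @cons_tuple_fun n = id) ?preimage_id; last first.
  apply/funext => -[x t]; rewrite /uncons /cons_tuple_fun/=; congr pair.
  by apply/val_inj.
by rewrite product_measure1E// lte_mul_pinfty// ge0_fin_numE.
Qed.

HB.instance Definition _ := Measure_isSigmaFinite.Build _ _ _ lebesgue_step
  lebesgue_step_sigma_finite.

End step.

Fixpoint lebesgue_tuple n : {sigma_finite_measure set (n.-tuple R) -> \bar R} :=
  match n with
  | 0 => \d_([tuple] : 0.-tuple R)
  | n'.+1 => lebesgue_step (lebesgue_tuple n')
  end.

End lebesgue_tuple.

Section facets.
Context {R : realType}.
Variables (d : nat) (b : R).

(* (z, r, phi): centre, size and orientation. *)
Definition mark := (d.-tuple R * R * d.-tuple R)%type.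

(* Indices start at 0: std_basis l stands for e_{l+1}. *)
Definition std_basis (l : nat) : d.-tuple R := [tuple (i == l :> nat)%:R | i < d].

Definition centre_box : set (d.-tuple R) :=
  [set z | forall i, 0 <= tnth z i <= b].

Lemma measurable_centre_box : measurable centre_box.
Proof.
rewrite (_ : centre_box =
    \bigcap_(i in [set: 'I_d]) ((fun z => tnth z i) @^-1` `[0, b])).
  apply: fin_bigcap_measurable => // i _.
  by rewrite -[X in measurable X]setTI; apply: measurable_tnth.
apply/seteqP; split=> z zP i.
  by move=> _; rewrite /preimage/= in_itv/=; exact: zP.
by have := zP i I; rewrite /preimage/= in_itv.
Qed.

(* The space Y of facets. *)
Definition facet_marks : set mark :=
  centre_box `*` [set 2 * b] `*` [set std_basis l | l in [set: 'I_d]].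

Definition facet (y : mark) : set (d.-tuple R) :=
  [set x | exists l : 'I_d, [/\ y.2 = std_basis l, tnth x l = tnth y.1.1 l &
    forall i, i != l -> `|tnth x i - tnth y.1.1 i| <= b]].

Definition orientation_measure : set (d.-tuple R) -> \bar R :=
  mscale (d%:R^-1)%:nng (msum (fun l => \d_(std_basis l)) d).

HB.instance Definition _ := Measure.on orientation_measure.

Let orientation_measure_fin : fin_num_fun orientation_measure.
Proof.
move=> A mA; rewrite /orientation_measure /mscale /msum fin_numM//.
by apply/sum_fin_numP => i _ _; rewrite fin_num_measure.
Qed.

HB.instance Definition _ :=
  Measure_isFinite.Build _ _ _ orientation_measure orientation_measure_fin.

(* The measure lambda; it is carried by facet_marks, and the restriction to
   centre_box is the density chi = 1 on [0, b]^d. *)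
Definition facet_intensity : set mark -> \bar R :=
  (mrestr (@lebesgue_tuple R d) measurable_centre_box \x \d_((2 * b)%R)
    \x orientation_measure)%E.

HB.instance Definition _ := Measure.on facet_intensity.

(* Integer-valued finite measures on Y with atoms of mass one, as finite
   subsets of Y. *)
Definition config : Type :=
  {x : {fset mark} | `[< [set` x] `<=` facet_marks >]}.

HB.instance Definition _ := Choice.on config.

Let config0_subproof : `[< [set` (fset0 : {fset mark})] `<=` facet_marks >].
Proof. by apply/asboolP => y /=; rewrite inE. Qed.

HB.instance Definition _ :=
  isPointed.Build config (exist _ fset0 config0_subproof).

(* x(B), for x seen as a measure. *)
Definition num_in (B : set mark) (x : config) : nat :=
  #|` [fset y in val x | y \in B]%fset |.

(* Y is a measurable subset of mark, so its Borel subsets are the measurable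
   subsets of mark contained in Y. *)
Definition count_events : set (set config) :=
  [set num_in B @^-1` K | B in [set B | measurable B /\ B `<=` facet_marks]
                       & K in [set: set nat]].

Definition config_space := g_sigma_algebraType count_events.

(* P is the distribution of a Poisson process with (finite) intensity measure
   Lambda. The second argument of poisson_prob is unused by its definition;
   a rate 0 gives the Dirac measure at 0. *)
Definition is_poisson_process (Lambda : set mark -> \bar R)
    (P : probability config_space R) : Prop :=
  (forall (B : set mark), measurable B -> B `<=` facet_marks ->
    forall K : set nat,
      pushforward P (num_in B : config_space -> nat) K =
      poisson_prob (fine (Lambda B)) 0 K) /\
  (forall (n : nat) (B : 'I_n -> set mark) (K : 'I_n -> set nat),
    (forall i, measurable (B i)) -> (forall i, B i `<=` facet_marks) ->
    trivIset setT B ->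
    P (\bigcap_(i in setT) (num_in (B i) @^-1` K i)) =
    (\prod_(i < n) P (num_in (B i) @^-1` K i))%E).

(* counting is +oo on infinite sets, so G may take the value +oo, where
   expeR (nu%:E * G x) = 0 for nu < 0. *)
Definition G (x : config) : \bar R :=
  ((d`!%:R^-1)%:E * \sum_(t : d.-tuple (val x) | uniq t)
    counting (\bigcap_(i in [set: 'I_d]) facet (val (tnth t i))))%E.

Definition norm_const (nu : R) (P : probability config_space R) : \bar R :=
  ((\int[P]_y expeR (nu%:E * G y))^-1)%E.

Definition density (nu : R) (P : probability config_space R)
    (x : config_space) : \bar R :=
  (norm_const nu P * expeR (nu%:E * G x))%E.

(* Q has density p with respect to P. *)
Definition has_density (P Q : probability config_space R)
    (p : config_space -> \bar R) : Prop :=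
  forall A, measurable A -> Q A = (\int[P]_(x in A) p x)%E.

Definition theta (x : config_space) : d.-tuple nat :=
  [tuple num_in (facet_marks `&` [set y | y.2 = std_basis i]) x | i < d].

End facets.

(* The iterated series of f over k_1 >= 1, ..., k_n >= 1, k_1 outermost. *)
Fixpoint iter_series (R : realType) (n : nat) :
    (n.-tuple nat -> \bar R) -> \bar R :=
  match n with
  | 0 => fun f => f [tuple]
  | n'.+1 => fun f =>
      (\sum_(1 <= k <oo) iter_series (fun t => f [tuple of k :: t]))%E
  end.

(* Main.v *)
Require Import Defs.
From mathcomp Require Import all_boot all_order all_algebra finmap.
From mathcomp Require Import all_classical all_reals all_analysis.
From mathcomp Require Import ring lra.

Set Implicit Arguments.
Unset Strict Implicit.
Unset Printing Implicit Defensive.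

Import Order.TTheory GRing.Theory Num.Theory.
Import numFieldNormedType.Exports.

Local Open Scope classical_set_scope.
Local Open Scope ring_scope.

(** Under the Poisson reference law the numbers N_0, ..., N_(d-1) of facets with
    each orientation are independent Poisson variables with the same parameter
    lam = a b^d / d (lemma prob_theta). All centres lie in [0, b]^d, so d facets
    with d different orientations always meet in a point, and the weight
    exp (nu G) penalizes the simultaneous presence of all orientations. On the
    other hand G vanishes almost surely when one orientation is missing. The
    Gibbs measure therefore prefers to pay the price exp (- lam) of losing one
    orientation, and this turns out to be cheaper than keeping all of them.

    Normalizing constant (normalizer_ge). The integral of exp (nu G) is at least
    the probability exp (- lam) that orientation 0 is absent, provided that G = 0
    almost surely on that event. If orientation 0 is absent, then among any d
    facets two are parallel, and parallel facets are disjoint unless they lie in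
    the same hyperplane. To see that this exception has probability 0 the box is
    cut into n slabs orthogonal to each axis: two coplanar facets lie in a common
    slab, and by prob_tied some slab contains two facets parallel to it with
    probability at most d lam^2 / n, for every n.

    Numerator. Tuples listing one facet of each orientation, in order, give
    G >= (N_0 ... N_(d-1)) / d! (lemma G_ge). With c = nu / d! < 0 and all counts
    positive, the weight is at most exp (c N_0 N_1). For every level s = e lam,
    either both N_0 and N_1 are at least s, or one of them is below s and the
    other one is still at least 1; expR_mul_le turns this into
      exp (c N_0 N_1) <= exp (c s^2) + exp (t (s - N_1) + c N_0)
                         + exp (t (s - N_0) + c N_1),
    a sum of functions of product form, whose Poisson expectations are explicit
    (poisson_generating). Multiplied by exp lam, the first term is
    exp (lam + c e^2 lam^2); each of the other two is exp of lam times
    t e - 1 + exp c + exp (- t), which is negative when t is large and e is small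
    (mass_exponential_bound). So the mass decays exponentially in lam.

    G enters only through these bounds: the integral of a nonnegative function is
    a supremum over the simple functions below it, hence monotone whether or not
    the function is measurable (ge0_le_nnintegral). *)

(** * Boxes and the intensity measure *)

Section boxes.
Context {R : realType}.

Definition tuple_box n (A : 'I_n -> set R) : set (n.-tuple R) :=
  [set z | forall i, A i (tnth z i)].

Lemma measurable_tuple_box n (A : 'I_n -> set R) :
  (forall i, measurable (A i)) -> measurable (tuple_box A).
Proof.
move=> mA.
rewrite (_ : tuple_box A =
    \bigcap_(i in [set: 'I_n]) ((fun z : n.-tuple R => tnth z i) @^-1` A i)).
  apply: fin_bigcap_measurable => // i _.
  by rewrite -[X in measurable X]setTI; apply: measurable_tnth.
by apply/seteqP; split=> z zP i; [move=> _; exact: zP | exact: zP].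
Qed.

Lemma measurable_tuple_set1 n (t : n.-tuple R) : measurable [set t].
Proof.
rewrite (_ : [set t] = tuple_box (fun i => [set tnth t i])).
  by apply: measurable_tuple_box => i; exact: measurable_set1.
apply/seteqP; split=> [z /= -> //|z /= zt]; apply/eq_from_tnth => i.
exact: zt.
Qed.

(** Induction on the dimension: splitting off the first coordinate turns the box
    into a rectangle for the product measure defining the next step. *)
Lemma lebesgue_tuple_box n (A : 'I_n -> set R) :
  (forall i, measurable (A i)) ->
  lebesgue_tuple n (tuple_box A) = (\prod_(i < n) lebesgue_measure (A i))%E.
Proof.
elim: n A => [|n IHn] A mA.
  rewrite big_ord0 /= diracE mem_set//.
  by move=> -[].
rewrite big_ord_recl -IHn; last by move=> i; exact: mA.
rewrite /= /lebesgue_step /pushforward.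
have mB : measurable (tuple_box (fun i : 'I_n => A (lift ord0 i))).
  by apply: measurable_tuple_box => i; exact: mA.
have E := product_measure1E lebesgue_measure (lebesgue_tuple n) (mA ord0) mB.
apply: etrans E.
congr (product_measure1 _ _ _); apply/seteqP; split=> -[x t] /=.
  move=> xt; split=> [|i]; first exact: (xt ord0).
  by have := xt (lift ord0 i); rewrite tnthS.
move=> [Ax At] i.
case: (unliftP ord0 i) => [j|] ->; first by rewrite tnthS; exact: At.
exact: Ax.
Qed.

End boxes.

Section cells.
Context {R : realType}.
Variables (d : nat) (b : R).

(** Orientations determine their index, so facets of different directions are
    told apart by their marks. *)
Lemma std_basis_inj : injective (fun l : 'I_d => @std_basis R d l).
Proof.
move=> l m /(congr1 (fun t => tnth t l)); rewrite !tnth_mktuple eqxx.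
case: eqP => [/val_inj//|_ /eqP]; by rewrite oner_eq0.
Qed.

Definition cell (A : 'I_d -> set R) (l : 'I_d) : set (mark d) :=
  tuple_box A `*` [set 2 * b] `*` [set @std_basis R d l].

Lemma measurable_cell A l : (forall i, measurable (A i)) ->
  measurable (cell A l).
Proof.
move=> mA; apply: measurableX; last exact: measurable_tuple_set1.
by apply: measurableX; [exact: measurable_tuple_box|exact: measurable_set1].
Qed.

Lemma cell_sub A l : (forall i, A i `<=` `[0, b]) ->
  cell A l `<=` @facet_marks R d b.
Proof.
move=> Ab [[z r] p] [[/= zA rb] pl]; split; last by exists l.
by split=> // i; have := Ab i _ (zA i); rewrite /= in_itv.
Qed.

Lemma facet_intensity_cell A l : (forall i, measurable (A i)) ->
  (forall i, A i `<=` `[0, b]) ->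
  facet_intensity b (cell A l) =
    ((\prod_(i < d) lebesgue_measure (A i)) * (d%:R^-1)%:E)%E.
Proof.
move=> mA Ab; rewrite /facet_intensity.
have mbox := measurable_tuple_box mA.
have mr : measurable [set 2 * b] by exact: measurable_set1.
rewrite product_measure1E/=; last 2 first.
- exact: measurableX.
- exact: measurable_tuple_set1.
rewrite product_measure1E//=.
rewrite diracE mem_set// mule1; congr (_ * _)%E.
  rewrite /mrestr (_ : _ `&` _ = tuple_box A); first exact: lebesgue_tuple_box.
  apply/setIidPl => z zA i.
  by have := Ab i _ (zA i); rewrite /= in_itv.
rewrite /orientation_measure /mscale /= /msum (bigD1 l)//= diracE mem_set//.
rewrite big1 ?adde0 ?mule1// => m ml; rewrite diracE memNset//=.
by move/std_basis_inj/eqP; rewrite (negPf ml).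
Qed.

End cells.

(** * Counting facets in cells and strips *)

Section configurations.
Context {R : realType}.
Variables (d : nat) (b : R).
Implicit Types (x : config d b) (B : set (mark (R := R) d)).

Lemma measurable_num_in B (K : set nat) :
  measurable B -> B `<=` facet_marks b ->
  measurable (num_in B @^-1` K : set (config_space d b)).
Proof.
move=> mB sB; apply: sub_sigma_algebra.
by exists B => //; exists K.
Qed.

(** Counting in the finite type of the facets of x, over which G sums. *)
Lemma num_inE B x : num_in B x = #|[pred y : val x | val y \in B]|.
Proof.
rewrite /num_in (_ : [fset y in val x | y \in B]%fset =
  [fset val y | y in [pred y : val x | val y \in B]]%fset).
  by rewrite card_imfset//=; [rewrite cardE | exact: val_inj].
apply/fsetP => y; apply/idP/imfsetP => /= [|[z]].
  by rewrite !inE/= => /andP[yx yB]; exists [` yx]%fset.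
by rewrite inE => zB ->; rewrite !inE/= mem_set// andbT; exact: fsvalP.
Qed.

Lemma num_in_ge2 B x (y z : val x) : y != z -> B (val y) -> B (val z) ->
  (1 < num_in B x)%N.
Proof.
move=> yz By Bz; rewrite num_inE; apply/card_gt1P; exists y, z.
by rewrite !inE.
Qed.

Definition full_cell (l : 'I_d) : set (mark d) := cell b (fun=> `[0, b]%classic) l.

Lemma full_cellE l :
  full_cell l = facet_marks b `&` [set y | y.2 = std_basis d l].
Proof.
apply/seteqP; split=> [y yl|[[z r] p] [[[/= zb rb] _] pl]].
  split; first by apply: (cell_sub _ yl) => i z.
  by case: yl => _ yl; exact: yl.
split=> //; split=> // i; rewrite /= in_itv/=; exact: zb.
Qed.

Lemma thetaE x l : tnth (theta x) l = num_in (full_cell l) x.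
Proof. by rewrite tnth_mktuple full_cellE. Qed.

Lemma mark_facet x (y : val x) : facet_marks b (val y).
Proof. by have /asboolP := valP x; apply; exact: (valP y). Qed.

Lemma full_cell_std x (y : val x) (l : 'I_d) : (val y).2 = std_basis d l ->
  full_cell l (val y).
Proof. by move=> yl; rewrite full_cellE; split=> //; exact: mark_facet. Qed.

(** The facets of direction l whose hyperplane meets the l-th axis in the j-th of
    n equal closed pieces of [0, b]. *)
Definition strip n (l : 'I_d) (j : nat) : set (mark d) :=
  cell b (fun i => if i == l then `[j%:R * (b / n%:R), j.+1%:R * (b / n%:R)]%classic
                   else `[0, b]%classic) l.

Lemma slab_cover (v c : R) n : (0 < n)%N -> 0 <= v -> v <= n%:R * c ->
  exists2 j, (j < n)%N & j%:R * c <= v <= j.+1%:R * c.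
Proof.
elim: n => // n IHn _ v0 vn.
case: (leP v (n%:R * c)) => [vn'|nv]; last by exists n => //; rewrite (ltW nv).
case: n IHn vn vn' => [_ v1 _|n IHn _ vn'].
  by exists 0%N => //; rewrite mul0r v0.
by have [j jn jv] := IHn isT v0 vn'; exists j => //; exact: ltnW.
Qed.

(** Some strip contains two facets. This event is measurable and contains every
    configuration with two coplanar parallel facets. *)
Definition tied n : set (config_space d b) :=
  \big[setU/set0]_(p : 'I_d * 'I_n)
     (num_in (strip n p.1 p.2) @^-1` [set k | (1 < k)%N]).

Lemma strip_itv n (j : 'I_n) : 0 <= b ->
  `[j%:R * (b / n%:R), j.+1%:R * (b / n%:R)] `<=` `[0, b].
Proof.
move=> b0; have n0 : 0 < n%:R :> R by rewrite ltr0n (leq_ltn_trans _ (ltn_ord j)).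
apply/subset_itvP/subset_itvScc => /=.
  by rewrite bnd_simp mulr_ge0// divr_ge0// ltW.
rewrite bnd_simp mulrA ler_pdivrMr// mulrC ler_wpM2l// ler_nat.
exact: ltn_ord.
Qed.

(** Coplanar parallel facets lie in a common strip, so without ties they must be
    the same facet. *)
Lemma untied_inj n x (y z : val x) (l : 'I_d) : 0 < b -> (0 < n)%N ->
  ~ tied n x -> (val y).2 = std_basis d l -> (val z).2 = std_basis d l ->
  tnth (val y).1.1 l = tnth (val z).1.1 l -> y = z.
Proof.
move=> b0 n0 nT yl zl yz; apply/eqP/negP => /negP neq; apply: nT.
have [ybox _] := full_cell_std yl; have [zbox _] := full_cell_std zl.
have := ybox.1 l; rewrite /= in_itv/= => /andP[v0 vb].
have [|j jn jv] := @slab_cover (tnth (val y).1.1 l) (b / n%:R) n n0 v0.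
  by rewrite mulrC divfK ?pnatr_eq0 -?lt0n.
rewrite /tied -bigcup_seq; exists (l, Ordinal jn); first by rewrite /= mem_index_enum.
have stripP (w : val x) : (val w).2 = std_basis d l ->
    tnth (val w).1.1 l = tnth (val y).1.1 l -> strip n l j (val w).
  move=> wl wy; have [[wbox wr] wo] := full_cell_std wl.
  split=> //; split=> // i /=; case: eqP => [->|_]; last exact: wbox.
  by rewrite /= in_itv/= wy.
(* y and z have the same l-th coordinate, so both lie in the strip of index j. *)
apply: (num_in_ge2 neq); first exact: stripP.
by apply: stripP => //; rewrite yz.
Qed.

Lemma measurable_strip n l (j : 'I_n) : measurable (strip n l j).
Proof. by apply: measurable_cell => i; case: ifP => _; exact: measurable_itv. Qed.

Lemma strip_sub n l (j : 'I_n) : 0 <= b -> strip n l j `<=` facet_marks b.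
Proof.
by move=> b0; apply: cell_sub => i; case: ifP => _ //; exact: strip_itv.
Qed.

Lemma lebesgue_itvcc (u v : R) : u <= v ->
  lebesgue_measure `[u, v]%classic = (v - u)%:E.
Proof.
move=> uv; rewrite lebesgue_measure_itv/= lte_fin.
by case: ltgtP uv => // -> _; rewrite subrr.
Qed.

Lemma intensity_full_cell l : 0 <= b ->
  facet_intensity b (full_cell l) = (b ^+ d / d%:R)%:E.
Proof.
move=> b0; rewrite facet_intensity_cell//; last by move=> i z.
rewrite lebesgue_itvcc// subr0 prodEFin -EFinM.
by rewrite prodr_const card_ord.
Qed.

(** A strip is a full cell with one side shrunk by the factor n. *)
Lemma intensity_strip n l (j : 'I_n) : 0 < b ->
  facet_intensity b (strip n l j) = (b ^+ d / d%:R / n%:R)%:E.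
Proof.
move=> b0; have n0 : 0 < n%:R :> R by rewrite ltr0n (leq_ltn_trans _ (ltn_ord j)).
rewrite facet_intensity_cell; last 2 first.
- by move=> i; case: ifP => _; exact: measurable_itv.
- by move=> i; case: ifP => _ //; exact: strip_itv (ltW b0).
rewrite (eq_bigr (fun i => (b * if i == l then n%:R^-1 else 1)%:E)); last first.
  move=> i _; case: ifP => _; rewrite lebesgue_itvcc ?subr0 ?mulr1 ?ltW//.
    by rewrite -mulrBl -natr1 addrC addKr mul1r.
  by rewrite ltr_pM2r ?divr_gt0// ltr_nat.
rewrite prodEFin -EFinM big_split/= prodr_const card_ord -big_mkcond/=.
by rewrite big_pred1_eq mulrAC.
Qed.

End configurations.

(** * Bounds on the interaction *)

Section interaction.
Context {R : realType}.
Variables (d : nat) (b : R).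
Implicit Types (x : config d b).

Lemma counting_ge1 (T : choiceType) (A : set T) : A !=set0 ->
  (1 <= counting A :> \bar R)%E.
Proof.
move=> [a Aa]; rewrite /counting; case: asboolP => [fA|_]; last exact: leey.
rewrite lee_fin ler1n cardfs_gt0; apply/fset0Pn; exists a.
by rewrite in_fset_set// mem_set.
Qed.

Lemma mark_orientation x (y : val x) : exists l : 'I_d, (val y).2 = std_basis d l.
Proof. by have [_ [l _ <-]] := mark_facet y; exists l. Qed.

(** If direction l0 is absent, the directions of d facets cannot be pairwise
    different, since an injective self-map of 'I_d would reach l0. Two of the
    facets are then parallel; a common point would make them coplanar. *)
Lemma G_untied n x (l0 : 'I_d) : 0 < b -> (0 < n)%N -> ~ tied n x ->
  num_in (full_cell b l0) x = 0%N -> G x = 0%E.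
Proof.
move=> b0 n0 nT x0; rewrite /G big1 ?mule0// => t ut.
rewrite (_ : \bigcap_(i in _) _ = set0) ?measure0//.
apply/eqP/negP => /negP/set0P[p tp].
have /choice[dir ot] : forall i, exists l : 'I_d, (val (tnth t i)).2 = std_basis d l.
  by move=> i; exact: mark_orientation.
have facet_o i : tnth p (dir i) = tnth (val (tnth t i)).1.1 (dir i).
  by have [l [ol pl _]] := tp i I; move: ol; rewrite ot => /std_basis_inj ->.
have o_inj : injective dir.
  move=> i j oij; apply/(tuple_uniqP _ ut).
  apply: (@untied_inj _ _ _ n x _ _ (dir i)) => //; first by rewrite ot oij.
  by rewrite -facet_o oij -facet_o.
have [i oi] : exists i, dir i = l0.
  by have /codomP[i] := inj_card_onto o_inj (leqnn _) l0; exists i.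
move: x0; rewrite num_inE => /card0_eq/(_ (tnth t i)).
by rewrite inE mem_set// -oi; exact: full_cell_std.
Qed.

(** The point whose i-th coordinate is that of the hyperplane of the i-th facet is
    within distance b of all the centres, because they lie in [0, b]^d. *)
Lemma facets_meet x (t : d.-tuple (val x)) :
  (forall i, full_cell b i (val (tnth t i))) ->
  \bigcap_(i in [set: 'I_d]) facet b (val (tnth t i)) !=set0.
Proof.
move=> tF; exists [tuple tnth (val (tnth t i)).1.1 i | i < d] => i _.
exists i; split; first by case: (tF i).
  by rewrite tnth_mktuple.
move=> j ji; rewrite tnth_mktuple.
have [[/(_ j) + _] _] := tF j; have [[/(_ j) + _] _] := tF i.
by rewrite /= !in_itv/= ler_norml; lra.
Qed.

(** Only the tuples whose i-th facet has direction i are counted; each is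
    automatically free of repetitions and contributes at least 1. The other
    orderings would cancel the factor d!, but the weaker bound is enough. *)
Lemma G_ge x : (((\prod_(i < d) num_in (full_cell b i) x)%:R / d`!%:R)%:E <= G x)%E.
Proof.
rewrite EFinM muleC /G lee_wpmul2l//.
pose toT (f : {ffun 'I_d -> val x}) : d.-tuple (val x) := [tuple f i | i < d].
rewrite (reindex toT)/=; last first.
  exists (fun t => [ffun i => tnth t i]) => t _.
    by apply/ffunP => i; rewrite ffunE tnth_mktuple.
  by apply/eq_from_tnth => i; rewrite tnth_mktuple ffunE.
pose F i := [pred y : val x | val y \in full_cell b i].
have FP f : f \in family F -> forall i, full_cell b i (val (tnth (toT f) i)).
  by move=> /familyP fF i; rewrite tnth_mktuple; have := fF i; rewrite inE.
rewrite (eq_bigr (fun i => \sum_(y | F i y) 1)%N); last first.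
  by move=> i _; rewrite num_inE sum1_card.
rewrite bigA_distr_big_dep/= (eq_bigr (fun=> 1%N)) ?sum1_card; last first.
  by move=> f _; rewrite big1.
rewrite (@le_trans _ _ (\sum_(f in family F) 1)%E)//.
  by rewrite sumEFin lee_fin sumr_const.
apply: (@le_trans _ _ (\sum_(f in family F)
   counting (\bigcap_(i in [set: 'I_d]) facet b (val (tnth (toT f) i)))))%E.
  by apply: lee_sum => f /FP fF; apply: counting_ge1; exact: facets_meet.
apply: lee_sum_nneg_subset => [f /FP fF|f _]; last exact: measure_ge0.
suff : uniq (toT f) by [].
apply/tuple_uniqP => i j tij; apply: (@std_basis_inj R d).
by have [_ <-] := fF i; have [_ <-] := fF j; rewrite tij.
Qed.

End interaction.

(** * Poisson counts and the Gibbs density *)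

Section poisson_law.
Context {R : realType}.
Implicit Types r : R.

Lemma poisson_prob_set1 r k : 0 < r ->
  poisson_prob r 0 [set k] = (poisson_pmf r k)%:E.
Proof.
by move=> r0; rewrite /poisson_prob r0 esum_set1// lee_fin poisson_pmf_ge0.
Qed.

(** 1 - (1 + r) exp (- r) <= r^2, from exp (- r) >= 1 - r. *)
Lemma poisson_prob_ge2 r : 0 < r ->
  (poisson_prob r 0 [set k | (1 < k)%N] <= (r ^+ 2)%:E)%E.
Proof.
move=> r0.
have -> : [set k | (1 < k)%N] = ~` ([set 0%N] `|` [set 1%N]).
  apply/seteqP; split=> [[|[|k]]|[|[|k]]]//=; first by move=> _ [].
    by move=> nk; exfalso; apply: nk; left.
  by move=> nk; exfalso; apply: nk; right.
rewrite probability_setC// measureU//; last first.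
  by apply/seteqP; split=> // k [/= ->].
rewrite /= !poisson_prob_set1//.
suff : 1 - (poisson_pmf r 0 + poisson_pmf r 1) <= r ^+ 2 by [].
rewrite /poisson_pmf r0.
rewrite expr0 expr1 fact0 factS fact0 muln1 invr1 !mulr1 mul1r.
have := expR_ge1Dx (- r); have := expR_gt0 (- r); nra.
Qed.

(** Any simple function below f is below g, so the suprema defining the two
    integrals compare even when f or g is not measurable. *)
Lemma ge0_le_nnintegral (dT : measure_display) (T : measurableType dT)
    (m : {measure set T -> \bar R}) (D : set T) (f g : T -> \bar R) :
  (forall x, D x -> (0 <= f x)%E) -> (forall x, D x -> (f x <= g x)%E) ->
  (\int[m]_(x in D) f x <= \int[m]_(x in D) g x)%E.
Proof.
move=> f0 fg; have g0 x : D x -> (0 <= g x)%E.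
  by move=> Dx; exact: le_trans (f0 _ Dx) (fg _ Dx).
rewrite !ge0_integralE//; apply: le_ereal_sup => _ /= [h hf <-].
exists h => // x; apply: le_trans (hf x) _.
by rewrite /patch; case: ifPn => // /set_mem; exact: fg.
Qed.

End poisson_law.

Section counts.
Context {R : realType}.
Variables (d : nat) (b a : R) (P : probability (config_space d b) R).
Hypotheses (d0 : (0 < d)%N) (b0 : 0 < b) (a0 : 0 < a).
Hypothesis PP : is_poisson_process (fun B => a%:E * facet_intensity b B)%E P.

Let lam := a * (b ^+ d / d%:R).

Let lam0 : 0 < lam.
Proof. by rewrite mulr_gt0// divr_gt0 ?exprn_gt0 ?ltr0n. Qed.

Lemma measurable_full_cell (l : 'I_d) : measurable (full_cell b l).
Proof. by apply: measurable_cell => i; exact: measurable_itv. Qed.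

Lemma full_cell_sub (l : 'I_d) : full_cell b l `<=` facet_marks b.
Proof. by apply: cell_sub => i z. Qed.

Lemma measurable_tied n : measurable (tied n : set (config_space d b)).
Proof.
apply: bigsetU_measurable => p _; apply: measurable_num_in.
  exact: measurable_strip.
exact: strip_sub (ltW b0).
Qed.

(** Union bound over the d n strips, each of intensity lam / n. *)
Lemma prob_tied n : (0 < n)%N ->
  (P (tied n) <= (d%:R * lam ^+ 2 / n%:R)%:E)%E.
Proof.
move=> n0.
have mS (p : 'I_d * 'I_n) : measurable
    (num_in (strip b n p.1 p.2) @^-1` [set k | (1 < k)%N] : set (config_space d b)).
  by apply: measurable_num_in; [exact: measurable_strip|exact: strip_sub (ltW b0)].
(* Measurability is carried along because each step of the union bound needs it. *)
have : measurable (tied n : set (config_space d b)) /\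
    (P (tied n) <= \sum_(p : 'I_d * 'I_n) ((lam / n%:R) ^+ 2)%:E)%E.
  rewrite /tied; elim/big_ind2: _ => [|A u B v [mA Au] [mB Bv]|p _].
  - by rewrite measure0.
  - split; first exact: measurableU.
    by apply: le_trans (measureU2 _ mA mB) _; exact: leeD.
  split => //; have [+ _] := PP.
  move=> /(_ _ (measurable_strip _ _ _) (strip_sub (ltW b0)) [set k | (1 < k)%N]).
  rewrite /pushforward => ->; rewrite intensity_strip// -EFinM/= mulrA.
  by apply: poisson_prob_ge2; rewrite divr_gt0// ltr0n.
move=> [_ /le_trans]; apply; rewrite sumEFin lee_fin sumr_const.
rewrite card_prod !card_ord -[leLHS]mulr_natr natrM.
suff -> : (lam / n%:R) ^+ 2 * (d%:R * n%:R) = d%:R * lam ^+ 2 / n%:R by [].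
have : n%:R != 0 :> R by rewrite pnatr_eq0 -lt0n.
move=> ?; field; done.
Qed.

Lemma prob_count (l : 'I_d) k :
  P (num_in (full_cell b l) @^-1` [set k]) = (poisson_pmf lam k)%:E.
Proof.
have [+ _] := PP.
move=> /(_ _ (measurable_full_cell l) (@full_cell_sub l) [set k]).
rewrite /pushforward => ->; rewrite intensity_full_cell ?ltW//.
by rewrite -EFinM/= poisson_prob_set1.
Qed.

Lemma theta_preimage (k : d.-tuple nat) : @theta R d b @^-1` [set k] =
  \bigcap_(i in [set: 'I_d]) (num_in (full_cell b i) @^-1` [set tnth k i]).
Proof.
apply/seteqP; split=> [x /= <- i _|x kx]; first by rewrite /= thetaE.
by apply/eq_from_tnth => i; rewrite thetaE; exact: kx.
Qed.

Lemma measurable_theta (k : d.-tuple nat) :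
  measurable (@theta R d b @^-1` [set k]).
Proof.
rewrite theta_preimage; apply: fin_bigcap_measurable => // i _.
by apply: measurable_num_in; [exact: measurable_full_cell|exact: full_cell_sub].
Qed.

Lemma prob_theta (k : d.-tuple nat) :
  P (@theta R d b @^-1` [set k]) = (\prod_(i < d) poisson_pmf lam (tnth k i))%:E.
Proof.
rewrite theta_preimage; have [_] := PP => ->; last 3 first.
- exact: measurable_full_cell.
- exact: full_cell_sub.
- apply/trivIsetP => i j _ _ ij; apply/seteqP; split=> // y [[_ +] [_]] => /= ->.
  by move/std_basis_inj/eqP; rewrite (negPf ij).
by rewrite -prodEFin; apply: eq_bigr => i _; exact: prob_count.
Qed.

(** On the event that direction 0 is absent and there is no tie, the integrand is
    1. The probability of this event is at least exp (- lam) - d lam^2 / n, and n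
    is arbitrary. *)
Lemma normalizer_ge (nu : R) : nu < 0 ->
  ((expR (- lam))%:E <= \int[P]_x expeR (nu%:E * G x))%E.
Proof.
move=> nu0; pose l0 := Ordinal d0.
pose E n := (num_in (full_cell b l0) @^-1` [set 0%N] : set (config_space d b))
  `\` tied n.
have mN : measurable (num_in (full_cell b l0) @^-1` [set 0%N] : set (config_space d b)).
  by apply: measurable_num_in; [exact: measurable_full_cell|exact: full_cell_sub].
have mE n : measurable (E n) by apply: measurableD => //; exact: measurable_tied.
have PE n : (0 < n)%N -> (P (E n) <= \int[P]_x expeR (nu%:E * G x))%E.
  move=> n0; rewrite -[leLHS]/(P (E n)) -(setIT (E n)) -integral_indic//.
  apply: ge0_le_nnintegral => x _; first by rewrite lee_fin indicE; case: (x \in E n).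
  rewrite indicE; case: (asboolP (E n x)) => [[x0 xT]|Ex].
    by rewrite mem_set// (G_untied b0 n0 xT x0) mule0 expeR0.
  by rewrite memNset// expeR_ge0.
apply/lee_addgt0Pr => e e0.
(* n makes the probability of a tie at most e. *)
pose n := (Num.truncn (d%:R * lam ^+ 2 / e)).+1.
have Tn : d%:R * lam ^+ 2 / n%:R <= e.
  rewrite ler_pdivrMr// [e * _]mulrC -ler_pdivrMr//; apply/ltW.
  exact: truncnS_gt.
apply: (@le_trans _ _ (P (E n) + P (tied n))%E); last first.
  apply: leeD; first exact: PE.
  by apply: le_trans (prob_tied _) _; rewrite ?lee_fin.
rewrite [leLHS](_ : _ = P (num_in (full_cell b l0) @^-1` [set 0%N])); last first.
  by rewrite prob_count /poisson_pmf lam0 expr0 fact0 invr1 !mul1r.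
apply: le_trans (measureU2 _ (mE n) (measurable_tied n)).
apply: le_measure; rewrite ?inE//.
  by apply: measurableU => //; exact: measurable_tied.
by move=> x x0; case: (pselect (tied n x)) => Tx; [right|left].
Qed.

(** The constant comes from normalizer_ge, the exponent from G_ge. *)
Lemma density_le (nu : R) (x : config d b) : nu < 0 ->
  (density nu P x <= (expR lam * expR (nu / d`!%:R *
     (\prod_(i < d) num_in (full_cell b i) x)%:R))%:E)%E.
Proof.
move=> nu0; have Ilam := normalizer_ge nu0.
have I0 : (0 <= \int[P]_y expeR (nu%:E * G y))%E.
  by apply: integral_ge0 => y _; exact: expeR_ge0.
rewrite /density EFinM; apply: lee_pmul.
- by rewrite inve_ge0.
- exact: expeR_ge0.
- rewrite /norm_const -[lam]opprK expRN.
  rewrite -[leRHS]/((expR (- lam))^-1%:E) -[leRHS](_ : ((expR (- lam))%:E^-1)%E = _).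
    by rewrite lee_pV2// inE lee_fin expR_ge0.
  by rewrite inver gt_eqF// expR_gt0.
rewrite -[leRHS]/(expeR (_%:E)) lee_expeR.
rewrite mulrAC -mulrA EFinM -[nu]opprK EFinN !mulNe leeN2.
by apply: lee_wpmul2l; [rewrite lee_fin oppr_ge0 ltW|exact: G_ge].
Qed.

Lemma density_theta_le (nu : R) (Q : probability (config_space d b) R)
    (k : d.-tuple nat) :
  nu < 0 -> has_density P Q (density nu P) ->
  (Q (@theta R d b @^-1` [set k]) <=
   (expR lam * (expR (nu / d`!%:R * (\prod_(i < d) tnth k i)%:R) *
    \prod_(i < d) poisson_pmf lam (tnth k i)))%:E)%E.
Proof.
move=> nu0 PQ; rewrite (PQ _ (measurable_theta k)) mulrA EFinM -prob_theta.
rewrite -integral_cst; last exact: measurable_theta.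
apply: ge0_le_nnintegral => x.
  move=> _; apply: mule_ge0; last exact: expeR_ge0.
  by rewrite inve_ge0; apply: integral_ge0 => y _; exact: expeR_ge0.
move=> /= <-; apply: le_trans (density_le x nu0) _.
by under [X in (_ <= (_ * expR (_ * X%:R))%:E)%E]eq_bigr do rewrite thetaE.
Qed.

End counts.

(** * Iterated series and Poisson transforms *)

Section iterated_series.
Context {R : realType}.
Local Open Scope ereal_scope.

Lemma cons_tuple_gt0 n k (t : n.-tuple nat) : (0 < k)%N ->
  (forall i, 0 < tnth t i)%N -> forall i, (0 < tnth [tuple of k :: t] i)%N.
Proof.
by move=> k0 t0 i; case: (unliftP ord0 i) => [j|] ->; rewrite ?tnthS ?tnth0.
Qed.

Lemma iter_series_ge0 n (f : n.-tuple nat -> \bar R) :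
  (forall k, 0 <= f k) -> 0 <= iter_series f.
Proof.
elim: n f => [|n IHn] f f0 /=; first exact: f0.
by apply: nneseries_ge0 => k _ _; exact: IHn.
Qed.

(** All series start at 1, so only tuples of positive integers are compared: this
    is where the hypothesis that every orientation is present enters. *)
Lemma le_iter_series n (f g : n.-tuple nat -> \bar R) :
  (forall k, 0 <= f k) ->
  (forall k, (forall i, 0 < tnth k i)%N -> f k <= g k) ->
  iter_series f <= iter_series g.
Proof.
elim: n f g => [|n IHn] f g f0 fg /=; first by apply: fg => -[].
rewrite eseries_cond [leRHS]eseries_cond.
apply: lee_nneseries => [k _ _|k /= k1]; first exact: iter_series_ge0.
by apply: IHn => // t t0; apply: fg; exact: cons_tuple_gt0.
Qed.

Lemma iter_seriesD n (f g : n.-tuple nat -> \bar R) :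
  (forall k, 0 <= f k) -> (forall k, 0 <= g k) ->
  iter_series (fun k => f k + g k) = iter_series f + iter_series g.
Proof.
elim: n f g => [//|n IHn] f g f0 g0 /=.
rewrite -nneseriesD; [|by move=> k _ _; exact: iter_series_ge0..].
by apply: eq_eseriesr => k _; exact: IHn.
Qed.

Lemma iter_seriesZ n (c : R) (f : n.-tuple nat -> \bar R) :
  (forall k, 0 <= f k) ->
  iter_series (fun k => c%:E * f k) = c%:E * iter_series f.
Proof.
elim: n f => [//|n IHn] f f0 /=.
rewrite -nneseriesZl; last by move=> k _; exact: iter_series_ge0.
by apply: eq_eseriesr => k _; exact: IHn.
Qed.

(** Tonelli for functions of product form; the terms of index 0 are added to each
    factor, which is why this is only an inequality. *)
Lemma iter_series_prod_le n (h : 'I_n -> nat -> R) (S : 'I_n -> R) :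
  (forall i k, (0 <= h i k)%R) ->
  (forall i, \sum_(0 <= k <oo) (h i k)%:E = (S i)%:E) ->
  iter_series (fun k : n.-tuple nat => (\prod_(i < n) h i (tnth k i))%:E)
    <= (\prod_(i < n) S i)%:E.
Proof.
elim: n h S => [|n IHn] h S h0 hS; first by rewrite /= !big_ord0.
have S0 i : (0 <= S i)%R.
  by rewrite -lee_fin -hS; apply: nneseries_ge0 => k _ _; rewrite lee_fin.
rewrite /= big_ord_recl EFinM -hS muleC -nneseriesZl; last first.
  by move=> k _; rewrite lee_fin.
apply: (@le_trans _ _ (\sum_(1 <= k <oo)
    ((\prod_(i < n) S (lift ord0 i))%:E * (h ord0 k)%:E))); last first.
  rewrite [leRHS]nneseries_recl//; last first.
    by move=> k _; rewrite -EFinM lee_fin mulr_ge0// prodr_ge0.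
  rewrite leeDr// -EFinM lee_fin mulr_ge0// prodr_ge0//.
apply: lee_nneseries => [k _ _|k _].
  by apply: iter_series_ge0 => t; rewrite lee_fin prodr_ge0.
rewrite muleC; apply: le_trans (lee_wpmul2l _ (IHn (fun i => h (lift ord0 i)) _ _ _)).
- rewrite -iter_seriesZ; last by move=> t; rewrite lee_fin prodr_ge0.
  apply: le_iter_series => [t|t _]; first by rewrite lee_fin prodr_ge0.
  rewrite -EFinM lee_fin big_ord_recl tnth0.
  by under eq_bigr do rewrite tnthS.
- by rewrite lee_fin.
- by [].
- by move=> i; exact: hS.
Qed.

End iterated_series.

Section poisson_transform.
Context {R : realType}.

Lemma poisson_pmf_series (r : R) : 0 < r ->
  (\sum_(0 <= k <oo) (poisson_pmf r k)%:E = 1)%E.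
Proof.
move=> r0; rewrite nneseries_esumT; last first.
  by move=> k; rewrite lee_fin poisson_pmf_ge0.
by have := probability_setT (poisson_prob r 0); rewrite /= /poisson_prob r0.
Qed.

(** w^k times the Poisson weight of parameter r is, up to the factor
    exp (- r (1 - w)), the Poisson weight of parameter r w. *)
Lemma poisson_generating (r w : R) : 0 < r -> 0 < w ->
  (\sum_(0 <= k <oo) (poisson_pmf r k * w ^+ k)%:E = (expR (- (r * (1 - w))))%:E)%E.
Proof.
move=> r0 w0; rewrite -[RHS]mule1 -(@poisson_pmf_series (r * w)) ?mulr_gt0//.
rewrite -nneseriesZl; last by move=> k _; rewrite lee_fin poisson_pmf_ge0.
apply: eq_eseriesr => k _; rewrite -EFinM; congr EFin.
rewrite /poisson_pmf r0 mulr_gt0// exprMn [RHS]mulrC -!mulrA -expRD.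
rewrite (_ : - (r * w) - r * (1 - w) = - r); last by ring.
by rewrite [w ^+ k * _]mulrCA -[expR _ * _]mulrC.
Qed.

End poisson_transform.

Section tail_estimate.
Context {R : realType}.

(** If k0 and k1 are at least s, then k0 * k1 >= s^2. If k1 < s, then
    exp (t (s - k1)) >= 1 while k0 * k1 >= k0, and symmetrically when k0 < s. *)
Lemma expR_mul_le (c t s k0 k1 : R) : c < 0 -> 0 < t -> 0 <= s ->
  1 <= k0 -> 1 <= k1 ->
  expR (c * (k0 * k1)) <=
    expR (c * s ^+ 2) + (expR (t * s) * (expR (c * k0) * expR (- t * k1)) +
                         expR (t * s) * (expR (- t * k0) * expR (c * k1))).
Proof.
move=> c0 t0 s0 k01 k11; rewrite -!expRD.
have e0 u := expR_ge0 (u : R).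
case: (leP s k0) => [sk0|k0s]; [case: (leP s k1) => [sk1|k1s]|].
- apply: (@le_trans _ _ (expR (c * s ^+ 2))); last by rewrite lerDl addr_ge0.
  by rewrite ler_expR ler_nM2l// expr2 ler_pM.
- apply: (@le_trans _ _ (expR (t * s + (c * k0 + - t * k1)))).
    have h1 : 0 <= - c * k0 * (k1 - 1) by rewrite !mulr_ge0 ?subr_ge0//; lra.
    have h2 : 0 <= t * (s - k1) by rewrite mulr_ge0 ?subr_ge0; lra.
    by rewrite ler_expR; nra.
  by rewrite [leRHS]addrCA lerDl addr_ge0.
- apply: (@le_trans _ _ (expR (t * s + (- t * k0 + c * k1)))).
    have h1 : 0 <= - c * k1 * (k0 - 1) by rewrite !mulr_ge0 ?subr_ge0//; lra.
    have h2 : 0 <= t * (s - k0) by rewrite mulr_ge0 ?subr_ge0; lra.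
    by rewrite ler_expR; nra.
  by rewrite [leRHS]addrA lerDr addr_ge0.
Qed.

End tail_estimate.

(** * Total mass of the configurations with all orientations *)

Section mass.
Context {R : realType}.
Variables (d : nat) (i0 i1 : 'I_d) (i01 : i1 != i0).

Definition pair_weight (u v : R) (i : 'I_d) : R :=
  if i == i0 then u else if i == i1 then v else 1.

Lemma prod_pair_weight (u v : R) (k : 'I_d -> nat) :
  \prod_(i < d) pair_weight u v i ^+ k i = u ^+ k i0 * v ^+ k i1.
Proof.
rewrite (bigD1 i0)//= (bigD1 i1)//= /pair_weight !eqxx (negPf i01).
rewrite big1 ?mulr1// => i /andP[/negPf -> /negPf ->]; exact: expr1n.
Qed.

(** The joint Poisson weights tilted by u^k_i0 v^k_i1, written as a product over
    all coordinates so that the iterated series factorizes. *)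
Definition poisson_weight (lam u v : R) (k : d.-tuple nat) : R :=
  \prod_(i < d) (poisson_pmf lam (tnth k i) * pair_weight u v i ^+ tnth k i).

Lemma poisson_weightE lam u v k : poisson_weight lam u v k =
  (\prod_(i < d) poisson_pmf lam (tnth k i)) * (u ^+ tnth k i0 * v ^+ tnth k i1).
Proof. by rewrite /poisson_weight big_split/= (prod_pair_weight _ _ (tnth k)). Qed.

Lemma pair_weight_gt0 u v i : 0 < u -> 0 < v -> 0 < pair_weight u v i.
Proof. by rewrite /pair_weight => u0 v0; case: ifP => // _; case: ifP. Qed.

Lemma poisson_weight_ge0 lam u v k : 0 < u -> 0 < v ->
  0 <= poisson_weight lam u v k.
Proof.
move=> u0 v0; apply: prodr_ge0 => i _; rewrite mulr_ge0 ?poisson_pmf_ge0//.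
by rewrite exprn_ge0// ltW// pair_weight_gt0.
Qed.

Lemma iter_series_poisson_weight lam u v : 0 < lam -> 0 < u -> 0 < v ->
  (iter_series (fun k => (poisson_weight lam u v k)%:E) <=
   (expR (- (lam * (1 - u)) - lam * (1 - v)))%:E)%E.
Proof.
move=> lam0 u0 v0.
have h0 i k : 0 <= poisson_pmf lam k * pair_weight u v i ^+ k.
  by rewrite mulr_ge0 ?poisson_pmf_ge0// exprn_ge0// ltW// pair_weight_gt0.
apply: le_trans (iter_series_prod_le h0
  (fun i => poisson_generating lam0 (pair_weight_gt0 i u0 v0))) _.
rewrite lee_fin (bigD1 i0)//= (bigD1 i1)//= big1 ?mulr1.
  by rewrite /pair_weight !eqxx (negPf i01) expRD.
move=> i /andP[/negPf i0' /negPf i1'].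
by rewrite /pair_weight i0' i1' subrr mulr0 oppr0 expR0.
Qed.

(** Two coordinates suffice: the remaining ones are at least 1. *)
Lemma le_prod_pair (k : d.-tuple nat) : (forall i, 0 < tnth k i)%N ->
  (tnth k i0 * tnth k i1 <= \prod_(i < d) tnth k i)%N.
Proof.
move=> k0; rewrite (bigD1 i0)//= (bigD1 i1)//= leq_mul2l leq_pmulr ?orbT//.
exact: prodn_gt0.
Qed.

(** Each of the three terms of expR_mul_le is a tilted Poisson weight, summed by
    iter_series_poisson_weight. *)
Lemma iter_series_mass_le (f : d.-tuple nat -> \bar R) (lam c t s : R) :
  0 < lam -> c < 0 -> 0 < t -> 0 <= s -> (forall k, 0 <= f k)%E ->
  (forall k, f k <= (expR lam * (expR (c * (\prod_(i < d) tnth k i)%:R) *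
     \prod_(i < d) poisson_pmf lam (tnth k i)))%:E)%E ->
  (iter_series f <=
   (expR lam * (expR (c * s ^+ 2) + 2 * (expR (t * s) *
      expR (- (lam * (1 - expR c)) - lam * (1 - expR (- t))))))%:E)%E.
Proof.
move=> lam0 c0 t0 s0 f0 fle.
have W0 u v k : 0 < u -> 0 < v -> (0 <= (poisson_weight lam u v k)%:E)%E.
  by move=> u0 v0; rewrite lee_fin poisson_weight_ge0.
have e0 (u : R) : 0 < expR u by exact: expR_gt0.
pose g k : \bar R := ((expR lam)%:E *
  ((expR (c * s ^+ 2))%:E * (poisson_weight lam 1 1 k)%:E +
   ((expR (t * s))%:E * (poisson_weight lam (expR c) (expR (- t)) k)%:E +
    (expR (t * s))%:E * (poisson_weight lam (expR (- t)) (expR c) k)%:E)))%E.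
apply: (@le_trans _ _ (iter_series g)).
  apply: le_iter_series => // k k0; apply: le_trans (fle k) _.
  rewrite lee_fin ler_pM2l// !poisson_weightE !expr1n !mulr1.
  set P := \prod_(i < d) poisson_pmf _ _.
  have P0 : 0 <= P by apply: prodr_ge0 => i _; exact: poisson_pmf_ge0.
  rewrite ![P * _]mulrC -!expRM_natr !mulrA -!mulrDl ler_wpM2r//.
  have := @expR_mul_le R c t s (tnth k i0)%:R (tnth k i1)%:R c0 t0 s0.
  rewrite !ler1n => /(_ (k0 _) (k0 _)); rewrite !mulrA; apply: le_trans.
  by rewrite ler_expR -mulrA ler_nM2l// -natrM ler_nat; exact: le_prod_pair.
rewrite /g iter_seriesZ; last first.
  by move=> k; rewrite !adde_ge0// mule_ge0// ?W0// lee_fin ltW.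
rewrite iter_seriesD; last 2 first.
- by move=> k; rewrite mule_ge0// ?W0// lee_fin ltW.
- by move=> k; rewrite !adde_ge0// mule_ge0// ?W0// lee_fin ltW.
rewrite iter_seriesD; last 2 first.
- by move=> k; rewrite mule_ge0// ?W0// lee_fin ltW.
- by move=> k; rewrite mule_ge0// ?W0// lee_fin ltW.
rewrite !iter_seriesZ; [|by move=> k; rewrite W0..].
rewrite EFinM; apply: lee_wpmul2l; first by rewrite lee_fin ltW.
rewrite mulr2n mulrDl mul1r 2!EFinD.
have bound u v w e : 0 < u -> 0 < v ->
    expR e * expR (- (lam * (1 - u)) - lam * (1 - v)) = w ->
    ((expR e)%:E * iter_series (fun k => (poisson_weight lam u v k)%:E) <= w%:E)%E.
  move=> u0 v0 <-; rewrite EFinM; apply: lee_wpmul2l; first by rewrite lee_fin ltW.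
  exact: iter_series_poisson_weight.
apply: leeD; [|apply: leeD]; apply: bound => //.
  by rewrite subrr mulr0 oppr0 addr0 expR0 mulr1.
by congr (_ * expR _); ring.
Qed.

End mass.

(** With q = 1 - exp c > 0, the exponent of the tail terms is lam times
    t e - q + exp (- t); taking exp (- t) = t e = q / 4 makes it - q lam / 2. The
    quadratic term needs - c e^2 lam >= 2, which gives the threshold L. *)
Lemma mass_exponential_bound {R : realType} (c : R) : c < 0 ->
  exists2 g : R, 0 < g & exists L t e : R, [/\ 0 < t, 0 < e &
    forall lam, 0 < lam -> L <= lam ->
    expR lam * (expR (c * (e * lam) ^+ 2) + 2 * (expR (t * (e * lam)) *
      expR (- (lam * (1 - expR c)) - lam * (1 - expR (- t))))) <=
    3 * expR (- (g * lam))].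
Proof.
move=> c0; pose q := 1 - expR c.
have q0 : 0 < q by rewrite subr_gt0 expR_lt1.
have q1 : q < 1 by rewrite gtrBl expR_gt0.
pose t := - ln (q / 4).
have t0 : 0 < t by rewrite oppr_gt0 ln_lt0// divr_gt0//=; lra.
have et : expR (- t) = q / 4 by rewrite opprK lnK// posrE; lra.
pose e := q / 4 / t.
have e0 : 0 < e by rewrite !divr_gt0.
have te : t * e = q / 4 by rewrite /e mulrCA divff ?mulr1// gt_eqF.
exists (q / 2); first lra.
exists (2 / (- c * e ^+ 2)), t, e; split => // lam lam0 Llam.
have L2 : 2 <= - c * e ^+ 2 * lam.
  by rewrite mulrC -ler_pdivrMr// mulr_gt0 ?oppr_gt0// exprn_gt0.
rewrite mulrDr.
rewrite [3 * _](_ : _ = expR (- (q / 2 * lam)) + 2 * expR (- (q / 2 * lam)));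
  last by ring.
apply: lerD.
  rewrite -expRD ler_expR exprMn.
  have : 2 * lam <= - c * e ^+ 2 * lam * lam by rewrite ler_pM2r.
  have : q * lam <= 1 * lam by rewrite ler_pM2r// ltW.
  nra.
rewrite mulrCA ler_pM2l// -!expRD ler_expR et -/q mulrA te.
by rewrite le_eqVlt; apply/orP; left; apply/eqP; rewrite /q; field.
Qed.

Theorem proposition2 (R : realType) (d : nat) (b nu : R)
    (eta mu : R -> probability (config_space d b) R) :
  (2 <= d)%N -> 0 < b -> nu < 0 ->
  (forall a : R, 1 <= a ->
    is_poisson_process (fun B => a%:E * facet_intensity b B)%E (eta a)) ->
  (forall a : R, 1 <= a ->
    has_density (eta a) (mu a) (density nu (eta a))) ->
  iter_series (fun k => pushforward (mu a) (@theta R d b) [set k])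
    @[a --> +oo] --> 0%E.
Proof.
move=> d2 b0 nu0 eta_poisson mu_density.
have d0 : (0 < d)%N by exact: ltn_trans d2.
pose i0 := Ordinal d0; pose i1 := Ordinal d2.
have i01 : i1 != i0 by [].
pose c := nu / d`!%:R.
have c0 : c < 0 by rewrite pmulr_llt0 ?invr_gt0 ?ltr0n ?fact_gt0.
pose v := b ^+ d / d%:R.
have v0 : 0 < v by rewrite divr_gt0 ?exprn_gt0 ?ltr0n.
have [g g0 [L [t [e [t0 e0 bound]]]]] := mass_exponential_bound c0.
apply: (@squeeze_cvge _ _ _ _ (fun=> 0%E) _
  (fun a => (3 * expR (- (g * (a * v))))%:E)).
- near=> a.
  have a1 : 1 <= a by near: a; apply: nbhs_pinfty_ge; exact: num_real.
  have a0 : 0 < a by exact: lt_le_trans a1.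
  have av0 : 0 < a * v by rewrite mulr_gt0.
  have Lav : L <= a * v.
    by rewrite -ler_pdivrMr//; near: a; apply: nbhs_pinfty_ge; exact: num_real.
  apply/andP; split; first by apply: iter_series_ge0 => k; exact: (measure_ge0 (mu a)).
  (* The level s of the counts is e lam with lam = a v. *)
  have /bound/(_ Lav) := av0; rewrite -lee_fin; apply: le_trans.
  apply: (iter_series_mass_le i01) => //; first by rewrite mulr_ge0 ?ltW.
    by move=> k; exact: (measure_ge0 (mu a)).
  move=> k.
  exact: (density_theta_le d0 b0 a0 (eta_poisson _ a1) k nu0 (mu_density _ a1)).
- exact: cvg_cst.
apply: cvg_EFin; first by near=> a.
rewrite -(mulr0 3); apply: cvgMl_tmp.
have lin : g * (a * v) @[a --> +oo] --> +oo.
  apply/cvgryPge => A; near=> a.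
  rewrite mulrCA -ler_pdivrMr ?(mulr_gt0 g0 v0)//.
exact: (cvg_comp _ _ lin (@cvgr_expR R)).
Unshelve. all: by end_near. Qed.
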